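(* Assume that: A1. The discrete spaces are $V_h=\bigoplus_i(V_{h,i}^0\oplus\mathcal R_{h,i}\Lambda_h)=V_h^0\oplus\mathcal R_h\Lambda_h$ and $W_h=\bigoplus_iW_{h,i}$. A2. The extension problem has a unique solution and the resulting extension operator $\mathcal R_h:\Lambda\to V_h$ is continuous, i.e. $\|\mathcal R_h\lambda\|_V\lesssim\|\lambda\|_\Lambda$ for all $\lambda\in\Lambda$. A3. With $a=\sum_ia_i$ and $b=\sum_ib_i$, the following four inequalities hold (the forms are continuous, $a$ is coercive, and the pair $V_h\times W_h$ is inf-sup stable): (i) $a(u_h,v_h)\lesssim\|u_h\|_V\|v_h\|_V$ for all $u_h,v_h\in V_h$; (ii) $b(v_h,w_h)\lesssim\|v_h\|_V\|w_h\|_W$ for all $v_h\in V_h$, $w_h\in W_h$; (iii) $a(v_h,v_h)\gtrsim\|v_h\|_V^2$ for all $v_h\in V_h$ with $b(v_h,w_h)=0$ for all $w_h\in W_h$; (iv) for all $w_h\in W_h$ there exists $0\ne v_h\in V_h$ such that $b(v_h,w_h)\gtrsim\|v_h\|_V\|w_h\|_W$. A4. The interpolant $\Pi^V$ is $b$-compatible: $b(u-\Pi^Vu,w_h)=0$ for all $w_h\in W_h$. Then the discrete problem: find $(u_h,p_h)\in V_h\times W_h$ such that $$\sum_ia_i(u_{h,i},v_{h,i})-\sum_ib_i(v_{h,i},p_{h,i})=\sum_i(g,v_{h,i})_{\Omega_i}\ \ \forall v_h\in V_h,\qquad\sum_ib_i(u_{h,i},w_{h,i})=\sum_i(f,w_{h,i})_{\Omega_i}\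 \ \forall w_h\in W_h$$ admits a unique solution that depends continuously on the data $f$. Moreover, with $(u,p)$ the solution of the continuous problem, the following a priori error estimate holds: $$\|u-u_h\|_V+\|p-p_h\|_W\lesssim\|\Pi^Vu-u\|_V+\|\Pi^Wp-p\|_W+\mathcal E_c,$$ with the consistency error defined as $$\mathcal E_c:=\sup_{v_h\in V_h}\frac{a(u,v_h)-b(v_h,p)-(g,v_h)_\Omega}{\|v_h\|_V}.$$
   Context: **Continuous problem.** $\tilde V\times\tilde W$ is a pair of function spaces on a domain $\Omega$ with a finite non-overlapping decomposition $\Omega=\bigcup_{i\in I_\Omega}\Omega_i$, interfaces $\Gamma_{ij}=\partial\Omega_i\cap\partial\Omega_j$, $\Gamma=\bigcup_{i<j}\Gamma_{ij}$, $\Gamma_i=\Gamma\cap\partial\Omega_i$. $(\cdot,\cdot)_G$ is the $L^2(G)$ inner product or duality pairing. Given bilinear forms $a_i,b_i$ and data $f,g$, $(u,p)\in\tilde V\times\tilde W$ satisfies $\sum_ia_i(u_i,v_i)-\sum_ib_i(v_i,p_i)=\sum_i(g,v_i)_{\Omega_i}$ for all $v\in\tilde V$ and $\sum_ib_i(u_i,w_i)=\sum_i(f,w_i)_{\Omega_i}$ for all $w\in\tilde W$; subscript $i$ denotes restriction to $\Omega_i$. **Spaces.** $V_i,W_i$ are the restrictions of $\tilde V,\tilde W$ to $\Omega_i$; $V=\bigoplus_iV_i$, $W=\bigoplus_iW_i$ with $\|v\|_V=\sum_i\|v_i\|_{V_i}$, $\|w\|_W=\sum_i\|w_i\|_{W_i}$.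 $\mathrm{Tr}_i$ is a trace operator on $V_i$ onto $\Gamma_i$ such that $\tilde V=\{v\in V:\mathrm{Tr}_iv_i=\mathrm{Tr}_jv_j\text{ on each }\Gamma_{ij}\}$; this defines a single-valued trace $\mathrm{Tr}$ on $\tilde V$. $\Lambda\subseteq\mathrm{Tr}\,\tilde V$ is an interface space with a suitable norm $\|\cdot\|_\Lambda$. $V_i^0=\{v\in V_i:\mathrm{Tr}_iv=0\}$. **Discretization.** For each $i$, $V_{h,i}\times W_{h,i}\subset V_i\times W_i$ is a stable mixed finite element pair for the corresponding subproblem on a mesh of $\Omega_i$; $V_{h,i}^0=V_{h,i}\cap V_i^0$, $V_h^0=\bigoplus_iV_{h,i}^0$; $\Lambda_h\subset\Lambda$ is a discrete interface space; $S_{H,i}=\{w\in W_i:b_i(v^0,w)=0\ \forall v^0\in V_i^0\}$; $\mathcal Q_{h,i}:\Lambda\to\mathrm{Tr}_iV_{h,i}$ is a chosen projection operator mapping interface data to the trace space of $V_{h,i}$. **Extension problem.** Given $\lambda\in\Lambda$, find $(\mathcal R_{h,i}\lambda,p_{h,i}^\lambda,r_i)\in V_{h,i}\times W_{h,i}\times S_{H,i}$ with $a_i(\mathcal R_{h,i}\lambda,v^0)-b_i(v^0,p_{h,i}^\lambda)=0$ for all $v^0\in V_{h,i}^0$; $b_i(\mathcal R_{h,i}\lambda,w)-(r_i,w)_{\Omega_i}=0$ for all $w\in W_{h,i}$; $(p_{h,i}^\lambda,s)_{\Omega_i}=0$ for all $s\in S_{H,i}$; $\mathrm{Tr}_i\mathcal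 R_{h,i}\lambda=\mathcal Q_{h,i}\lambda$ on $\Gamma_i$. $\mathcal R_h=\bigoplus_i\mathcal R_{h,i}$. **Interpolants.** $\Pi^V,\Pi^W,\Pi^\Lambda$ denote interpolants onto $V_h,W_h,\Lambda_h$, assumed to have suitable approximation properties (errors bounded by powers of the mesh sizes times Sobolev norms of the interpolated functions). $a\lesssim b$ means $a\le Cb$ with $C>0$ independent of the mesh size $h$; $\gtrsim$ analogously.
   Formalization: The forms $a_i,b_i$ are additionally assumed bounded on the whole spaces $V_i\times V_i$ and $V_i\times W_i$ (not only on the discrete spaces), and $W_h\subset\tilde W$ is assumed; without either one the error estimate can fail. *)

(* Defs.v *)
From HB Require Import structures.
From mathcomp Require Import all_boot all_order all_algebra.
From mathcomp Require Import sesquilinear.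
From mathcomp Require Import all_classical all_reals all_analysis.

Set Implicit Arguments.
Unset Strict Implicit.
Unset Printing Implicit Defensive.

Import Order.TTheory GRing.Theory Num.Theory.
Import numFieldNormedType.Exports.

Local Open Scope classical_set_scope.
Local Open Scope ring_scope.

Definition boundary (T : topologicalType) (A : set T) : set T :=
  closure A `\` A°.

Definition bounded_form (R : realType) (U U' : normedModType R)
    (f : U -> U' -> R) : Prop :=
  exists M : R, forall x y, `|f x y| <= M * `|x| * `|y|.

Definition finite_dim_subspace (R : realType) (U : lmodType R) (A : set U) :
    Prop :=
  exists (n : nat) (e : 'I_n -> U),
    A = [set \sum_(k < n) c k *: e k | c in [set: 'I_n -> R]].

Unset Implicit Arguments.

(* A function on Omega is represented by the family of its restrictions to
   the subdomains.  Traces are (possibly generalized) functions on pieces of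
   the skeleton: [trsp G] is the space of functions on [G] and [res G G'] the
   restriction, only meaningful when [G'] is a subset of [G]. *)
Record saddle_problem {R : realType} := SaddleProblem {
  dim : nat ;
  Omega : set 'rV[R]_dim ;
  Omega_open : open Omega ;
  Omega_connected : connected Omega ;
  Omega_neq0 : Omega !=set0 ;

  sub : finType ;
  Om : sub -> set 'rV[R]_dim ;
  Om_open : forall i, open (Om i) ;
  Om_neq0 : forall i, Om i !=set0 ;
  Om_sub : forall i, Om i `<=` Omega ;
  Om_disj : forall i j, i != j -> Om i `&` Om j = set0 ;
  Om_cover : closure Omega = \bigcup_i closure (Om i) ;

  Gam2 : sub -> sub -> set 'rV[R]_dim :=
    fun i j => boundary (Om i) `&` boundary (Om j) ;
  Gam : set 'rV[R]_dim := \bigcup_(z in [set z : sub * sub | z.1 != z.2])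
    Gam2 z.1 z.2 ;
  Gam1 : sub -> set 'rV[R]_dim := fun i => Gam `&` boundary (Om i) ;

  V : sub -> normedModType R ;
  W : sub -> normedModType R ;

  trsp : set 'rV[R]_dim -> lmodType R ;
  res : forall G G', {linear trsp G -> trsp G'} ;
  res_id : forall G x, res G G x = x ;
  res_comp : forall G1 G2 G3 x, G2 `<=` G1 -> G3 `<=` G2 ->
    res G2 G3 (res G1 G2 x) = res G1 G3 x ;
  res_inj : forall x y : trsp Gam,
    (forall i, res Gam (Gam1 i) x = res Gam (Gam1 i) y) -> x = y ;
  tri : forall i, {linear V i -> trsp (Gam1 i)} ;

  Vtilde : set (forall i, V i) :=
    [set v | forall i j, i != j ->
       res (Gam1 i) (Gam2 i j) (tri i (v i)) =
       res (Gam1 j) (Gam2 i j) (tri j (v j))] ;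
  V_restr : forall i x, exists2 v, Vtilde v & v i = x ;
  Wtilde : set (forall i, W i) ;
  Wtilde0 : Wtilde (fun=> 0) ;
  Wtilde_lin : forall (c : R) w w', Wtilde w -> Wtilde w' ->
    Wtilde (fun i => c *: w i + w' i) ;
  W_restr : forall i x, exists2 w, Wtilde w & w i = x ;

  tr : (forall i, V i) -> trsp Gam ;
  trE : forall v, Vtilde v -> forall i, res Gam (Gam1 i) (tr v) = tri i (v i) ;

  Lam : normedModType R ;
  Lam_tr : {linear Lam -> trsp Gam} ;
  Lam_tr_inj : injective Lam_tr ;
  Lam_sub : forall l, exists2 v, Vtilde v & tr v = Lam_tr l ;

  a_ : forall i, {bilinear V i -> V i -> R | *%R & *%R} ;
  b_ : forall i, {bilinear V i -> W i -> R | *%R & *%R} ;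
  a_bounded : forall i, bounded_form (a_ i) ;
  b_bounded : forall i, bounded_form (b_ i) ;

  (* [pairV i g v] and [pairW i f w] are the L2 inner product or duality
     pairing on the i-th subdomain; [W i] is embedded in the space [datW i]
     of the data f, and there the pairing is the L2 inner product. *)
  datV : sub -> normedModType R ;
  datW : sub -> normedModType R ;
  pairV : forall i, {bilinear datV i -> V i -> R | *%R & *%R} ;
  pairW : forall i, {bilinear datW i -> W i -> R | *%R & *%R} ;
  pairV_bounded : forall i, bounded_form (pairV i) ;
  pairW_bounded : forall i, bounded_form (pairW i) ;
  incW : forall i, {linear W i -> datW i} ;
  pairW_sym : forall i w w', pairW i (incW i w) w' = pairW i (incW i w') w ;
  pairW_gt0 : forall i w, w != 0 -> 0 < pairW i (incW i w) w ;

  (* Sobolev norms controlling the interpolation errors; +oo on functions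
     that are not regular enough *)
  sobV : (forall i, V i) -> \bar R ;
  sobW : (forall i, W i) -> \bar R ;
  sobL : Lam -> \bar R ;
  sobV_ge0 : forall v, (0 <= sobV v)%E ;
  sobW_ge0 : forall w, (0 <= sobW w)%E ;
  sobL_ge0 : forall l, (0 <= sobL l)%E
}.

Arguments saddle_problem R : clear implicits.

Set Implicit Arguments.

Section problem.
Variables (R : realType) (P : saddle_problem R).

Definition Vsp := forall i : sub P, V P i.
Definition Wsp := forall i : sub P, W P i.
Definition datVsp := forall i : sub P, datV P i.
Definition datWsp := forall i : sub P, datW P i.

Definition normV (v : Vsp) : R := \sum_i `|v i|.
Definition normW (w : Wsp) : R := \sum_i `|w i|.
Definition normdatW (f : datWsp) : R := \sum_i `|f i|.

Definition subV (v v' : Vsp) : Vsp := fun i => v i - v' i.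
Definition subW (w w' : Wsp) : Wsp := fun i => w i - w' i.
Definition subdatW (f f' : datWsp) : datWsp := fun i => f i - f' i.

Definition aform (u v : Vsp) : R := \sum_i a_ P i (u i) (v i).
Definition bform (v : Vsp) (w : Wsp) : R := \sum_i b_ P i (v i) (w i).
Definition dualV (g : datVsp) (v : Vsp) : R := \sum_i pairV P i (g i) (v i).
Definition dualW (f : datWsp) (w : Wsp) : R := \sum_i pairW P i (f i) (w i).

Definition V0 (i : sub P) : set (V P i) := [set v | tri P i v = 0].
Arguments V0 : clear implicits.

Definition SH (i : sub P) : set (W P i) :=
  [set w | forall v0, V0 i v0 -> b_ P i v0 w = 0].

Definition continuous_solution (f : datWsp) (g : datVsp) (u : Vsp) (p : Wsp) :
    Prop :=
  [/\ Vtilde P u, Wtilde P p,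
      forall v, Vtilde P v -> aform u v - bform v p = dualV g v
    & forall w, Wtilde P w -> bform u w = dualW f w].

End problem.

Arguments V0 {R} P i.
Arguments SH {R} P i.

Unset Implicit Arguments.

(* [mesh] indexes the family of discretizations, with mesh size [msize].
   Constants hidden in the symbol "lesssim" do not depend on the index. *)
Record discretization {R : realType} {P : saddle_problem R} := Discretization {
  mesh : Type ;
  msize : mesh -> R ;
  msize_gt0 : forall h, 0 < msize h ;

  Vhi : mesh -> forall i : sub P, set (V P i) ;
  Whi : mesh -> forall i : sub P, set (W P i) ;
  Vhi_fin : forall h i, finite_dim_subspace (Vhi h i) ;
  Whi_fin : forall h i, finite_dim_subspace (Whi h i) ;
  Vhi0 : mesh -> forall i : sub P, set (V P i) :=
    fun h i => Vhi h i `&` V0 P i ;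

  (* Stability of the pairs for the subproblem with zero trace on the i-th
     interface, whose multiplier is determined up to [SH i] *)
  stable_coer : forall i, exists2 c : R, 0 < c &
    forall h v, Vhi0 h i v -> (forall w, Whi h i w -> b_ P i v w = 0) ->
      c * `|v| ^+ 2 <= a_ P i v v ;
  stable_infsup : forall i, exists2 c : R, 0 < c &
    forall h w, Whi h i w ->
      (forall s, SH P i s -> pairW P i (incW P i w) s = 0) -> w != 0 ->
      exists v, [/\ Vhi0 h i v, v != 0 & c * `|v| * `|w| <= b_ P i v w] ;

  Lh : mesh -> set (Lam P) ;
  Lh_fin : forall h, finite_dim_subspace (Lh h) ;

  Qh : mesh -> forall i : sub P, {linear Lam P -> trsp P (Gam1 P i)} ;
  Qh_range : forall h i l, exists2 v, Vhi h i v & Qh h i l = tri P i v ;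
  Qh_proj : forall h i l v, Vhi h i v ->
    res P (Gam P) (Gam1 P i) (Lam_tr P l) = tri P i v -> Qh h i l = tri P i v ;

  Vh : mesh -> set (Vsp P) ;
  Wh : mesh -> set (Wsp P) ;
  (* the second equation of the continuous problem can be tested with the
     discrete multipliers *)
  Wh_conform : forall h, Wh h `<=` Wtilde P ;

  PiV : mesh -> Vsp P -> Vsp P ;
  PiW : mesh -> Wsp P -> Wsp P ;
  PiL : mesh -> Lam P -> Lam P ;
  PiV_range : forall h, range (PiV h) = Vh h ;
  PiW_range : forall h, range (PiW h) = Wh h ;
  PiL_range : forall h, range (PiL h) = Lh h ;
  PiV_approx : exists k C : R, [/\ 0 < k, 0 < C &
    forall h v, ((normV (subV v (PiV h v)))%:E <=
                 (C * msize h `^ k)%:E * sobV P v)%E] ;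
  PiW_approx : exists k C : R, [/\ 0 < k, 0 < C &
    forall h w, ((normW (subW w (PiW h w)))%:E <=
                 (C * msize h `^ k)%:E * sobW P w)%E] ;
  PiL_approx : exists k C : R, [/\ 0 < k, 0 < C &
    forall h l, (`|l - PiL h l|%:E <= (C * msize h `^ k)%:E * sobL P l)%E]
}.

Arguments discretization {R} P.

Set Implicit Arguments.

Section discrete.
Variables (R : realType) (P : saddle_problem R) (D : discretization P).

Definition Vh0 (h : mesh D) : set (Vsp P) :=
  [set v | forall i, Vhi0 D h i (v i)].

Definition extension_solution (h : mesh D) (i : sub P) (l : Lam P) :
    set (V P i * W P i * W P i) :=
  [set x | let: (Rl, pl, r) := x in
    [/\ [/\ Vhi D h i Rl, Whi D h i pl & SH P i r],
        forall v0, Vhi0 D h i v0 -> a_ P i Rl v0 - b_ P i v0 pl = 0,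
        forall w, Whi D h i w -> b_ P i Rl w - pairW P i (incW P i r) w = 0,
        forall s, SH P i s -> pairW P i (incW P i pl) s = 0
      & tri P i Rl = Qh D h i l]].

(* The extension is determined as soon as the extension problem is uniquely
   solvable; otherwise [xget] returns an arbitrary solution, or 0. *)
Definition Rhi (h : mesh D) (i : sub P) (l : Lam P) : V P i :=
  (xget 0 (extension_solution h l)).1.1.

Definition Rh (h : mesh D) (l : Lam P) : Vsp P := fun i => Rhi h i l.

(* A single interface datum is extended to all the subdomains: the second
   summand is { Rh l | l in Lh }, not the direct sum over i of
   { Rhi l | l in Lh }. *)
Definition A1 : Prop := forall h : mesh D,
  [/\ Vh D h = [set (fun i => z.1 i + z.2 i) | z in Vh0 h `*` (Rh h @` Lh D h)],
      Vh0 h `&` (Rh h @` Lh D h) = [set fun=> 0],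
      forall i, Vhi0 D h i `&` (Rhi h i @` Lh D h) = [set 0]
    & Wh D h = [set w | forall i, Whi D h i (w i)]].

Definition A2 : Prop :=
  (forall (h : mesh D) i (l : Lam P), exists! x, @extension_solution h i l x) /\
  exists2 C : R, 0 < C &
    forall (h : mesh D) (l : Lam P), normV (Rh h l) <= C * `|l|.

Definition a_continuous : Prop :=
  exists2 C : R, 0 < C & forall (h : mesh D) (u v : Vsp P),
    Vh D h u -> Vh D h v -> aform u v <= C * normV u * normV v.

Definition b_continuous : Prop :=
  exists2 C : R, 0 < C & forall (h : mesh D) (v : Vsp P) (w : Wsp P),
    Vh D h v -> Wh D h w -> bform v w <= C * normV v * normW w.

Definition a_coercive : Prop :=
  exists2 c : R, 0 < c & forall (h : mesh D) (v : Vsp P),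
    Vh D h v -> (forall w, Wh D h w -> bform v w = 0) ->
    c * normV v ^+ 2 <= aform v v.

Definition b_infsup : Prop :=
  exists2 c : R, 0 < c & forall (h : mesh D) (w : Wsp P), Wh D h w ->
    exists v : Vsp P,
      [/\ Vh D h v, v <> (fun=> 0) & c * normV v * normW w <= bform v w].

Definition A3 : Prop := [/\ a_continuous, b_continuous, a_coercive & b_infsup].

Definition A4 (u : Vsp P) : Prop :=
  forall (h : mesh D) w, Wh D h w -> bform (subV u (PiV D h u)) w = 0.

Definition discrete_solution (h : mesh D) (f : datWsp P) (g : datVsp P)
    (uh : Vsp P) (ph : Wsp P) : Prop :=
  [/\ Vh D h uh, Wh D h ph,
      forall v, Vh D h v -> aform uh v - bform v ph = dualV g v
    & forall w, Wh D h w -> bform uh w = dualW f w].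

Definition consistency_error (h : mesh D) (g : datVsp P) (u : Vsp P)
    (p : Wsp P) : \bar R :=
  ereal_sup [set ((aform u v - bform v p - dualV g v) / normV v)%:E |
             v in [set v : Vsp P | Vh D h v /\ v <> (fun=> 0)]].

End discrete.

(* Main.v *)
Require Import Defs.
From HB Require Import structures.
From mathcomp Require Import all_boot all_order all_algebra.
From mathcomp Require Import sesquilinear.
From mathcomp Require Import all_classical all_reals all_analysis.
From mathcomp Require Import ring lra.
Import Order.TTheory GRing.Theory Num.Theory.
Import numFieldNormedType.Exports.
Local Open Scope classical_set_scope.
Local Open Scope ring_scope.

(* The space [V_h] is a finite-dimensional subspace because the extension
   operator is linear, which follows from the unique solvability of the
   extension problem.  Discrete existence then reduces to a finite square
   linear system whose transposed kernel is trivial by coercivity on the kernel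
   of [b] and the inf-sup condition.  Stability in [f] is obtained by testing
   with the solution of an adjoint problem whose datum is a norming functional
   of [u_h]; such a functional is built by Hahn-Banach on the finite-dimensional
   space.  For the error, [b]-compatibility puts [u_h - PiV u] in the kernel of
   [b], where coercivity applies, and the inf-sup condition bounds
   [p_h - PiW p]; the boundedness of [a] and [b] on the whole spaces handles the
   interpolation errors, and the residual of [(u, p)] on [V_h] is the
   consistency error. *)

Set Implicit Arguments.
Unset Strict Implicit.

(** * Finite-dimensional linear algebra: subspaces in coordinates and square systems *)

(** Take [M] of maximal rank among the matrices whose rows span vectors of [A]: adjoining some [x]
    in [A] cannot raise the rank, so [x] is already in the row space. *)
Lemma subspace_rowspace (F : fieldType) n (A : set 'rV[F]_n) :
  A 0 -> (forall c x y, A x -> A y -> A (c *: x + y)) ->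
  exists M : 'M[F]_n, forall x, A x <-> (x <= M)%MS.
Proof.
move=> A0 Alin.
pose inA (M : 'M[F]_n) := `[< forall x, (x <= M)%MS -> A x >].
pose Q r := `[< exists2 M, inA M & \rank M = r >].
have Q0 : exists r, Q r.
  exists 0%N; apply/asboolP; exists 0; last exact: mxrank0.
  by apply/asboolP => x; rewrite submx0 => /eqP ->.
have Qn r : Q r -> (r <= n)%N.
  by move=> /asboolP[M _ <-]; exact: rank_leq_row.
have [r /asboolP[M /asboolP MA rM] rmax] := ex_maxnP Q0 Qn.
exists M => x; split=> [Ax|]; last exact: MA.
have Mx : inA (M + <<x>>)%MS.
  apply/asboolP => z /sub_addsmxP[[u v] /= ->].
  have /sub_rVP[k ->] : (v *m <<x>> <= x)%MS.
    by rewrite (submx_trans (submxMl _ _))// genmxE.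
  by rewrite addrC; apply: Alin => //; apply: MA; exact: submxMl.
have rk : (\rank (M + <<x>>)%MS <= \rank M)%N.
  by rewrite rM; apply: rmax; apply/asboolP; exists (M + <<x>>)%MS.
have /mxrank_leqif_sup[_ rkE] := addsmxSl M <<x>>%MS.
have : (M + <<x>> <= M)%MS by rewrite -rkE eqn_leq rk (mxrankS (addsmxSl _ _)).
by rewrite addsmx_sub genmxE => /andP[].
Qed.

Lemma scalar_row_expansion (F : fieldType) n (f : 'rV[F]_n -> F) x :
  scalar f -> f x = \sum_j x 0 j * f (delta_mx 0 j).
Proof.
move=> fl; have f0 : f 0 = 0.
  by have := fl (-1) 0 0; rewrite scaler0 addr0 /= mulN1r addNr.
rewrite [in LHS](row_sum_delta x).
elim/big_rec2: _ => // j a y _ <-.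
by rewrite fl.
Qed.

(** Fredholm alternative. The kernel condition concerns [L] rather than triviality of the kernel,
    because the coordinates to which it is applied may be redundant. *)
Lemma galerkin_solvable (F : fieldType) n (B : 'rV[F]_n -> 'rV[F]_n -> F)
    (L : 'rV[F]_n -> F) :
  (forall y, scalar (B^~ y)) -> (forall x, scalar (B x)) -> scalar L ->
  (forall y, (forall x, B x y = 0) -> L y = 0) ->
  exists x, forall y, B x y = L y.
Proof.
move=> Bl Br Ll ker.
pose G := \matrix_(i, j) B (delta_mx 0 i) (delta_mx 0 j).
pose l : 'rV[F]_n := \row_j L (delta_mx 0 j).
have BE x y : B x y = (x *m (G *m y^T)) 0 0.
  rewrite (scalar_row_expansion x (Bl y)) !mxE; apply: eq_bigr => i _.
  rewrite (scalar_row_expansion y (Br _)) !mxE; congr (_ * _).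
  by apply: eq_bigr => j _; rewrite !mxE mulrC.
have LE y : L y = (l *m y^T) 0 0.
  rewrite (scalar_row_expansion y Ll) !mxE.
  by apply: eq_bigr => j _; rewrite !mxE mulrC.
have /submxP[x lx] : (l <= G)%MS.
  rewrite submxE; apply/eqP/rowP => k.
  (* The columns of the cokernel of [G] are test vectors annihilated by [B], so [L] vanishes on
     them; this places [l] in the row space of [G]. *)
  pose y := (col k (cokermx G))^T.
  have Gy : G *m y^T = 0.
    by rewrite trmxK colE mulmxA mulmx_coker mul0mx.
  have -> : (l *m cokermx G) 0 k = L y.
    by rewrite LE trmxK colE mulmxA -colE [RHS]mxE.
  rewrite ker.
    by rewrite mxE.
  by move=> x; rewrite BE Gy mulmx0 mxE.
by exists x => y; rewrite BE mulmxA -lx LE.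
Qed.

Lemma subspace_param (R : realType) (I : finType) (E : I -> lmodType R)
    (X : forall i, set (E i)) (S : set (forall i, E i)) :
  (forall i, finite_dim_subspace (X i)) ->
  (forall x, S x -> forall i, X i (x i)) ->
  S (fun=> 0) ->
  (forall (c : R) x y, S x -> S y -> S (fun i => c *: x i + y i)) ->
  exists n (phi : 'rV[R]_n -> forall i, E i),
    (forall c x y, phi (c *: x + y) = (fun i => c *: phi x i + phi y i)) /\
    S = range phi.
Proof.
move=> Xfin SX S0 Slin.
have /all_sig[n /(_ _)/cid-/all_sig[e eP]] i := cid (Xfin i).
pose T : finType := {i : I & 'I_(n i)}.
pose psi (x : 'rV[R]_#|T|) i : E i :=
  \sum_(k < n i) x 0 (enum_rank (Tagged (fun i => 'I_(n i)) k)) *: e i k.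
have psil c x y : psi (c *: x + y) = (fun i => c *: psi x i + psi y i).
  apply: functional_extensionality_dep => i.
  rewrite /psi scaler_sumr -big_split; apply: eq_bigr => k _ /=.
  by rewrite !mxE scalerDl scalerA.
have psi0 : psi 0 = fun=> 0.
  apply: functional_extensionality_dep => i.
  by rewrite /psi big1// => k _; rewrite mxE scale0r.
have [|c x y|M MP] := @subspace_rowspace R _ [set x | S (psi x)].
- by rewrite /= psi0.
- by rewrite /= psil; exact: Slin.
(* The row space of [M] is the set of coordinates of elements of [S], so composing with [M] makes
   the range exactly [S]. *)
exists #|T|, (fun x => psi (x *m M)); split => [c x y|].
  by rewrite mulmxDl -scalemxAl psil.
apply/seteqP; split=> [v Sv|_ [x _ <-]]; last by apply/MP; exact: submxMl.
have /all_sig[c cP] i : {c : 'I_(n i) -> R | \sum_(k < n i) c k *: e i k = v i}.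
  by apply: cid; have := SX _ Sv i; rewrite eP => -[c _ <-]; exists c.
pose x : 'rV[R]_#|T| := \row_j c (tag (enum_val j)) (tagged (enum_val j)).
have xv : psi x = v.
  apply: functional_extensionality_dep => i; rewrite -cP.
  by apply: eq_bigr => k _; rewrite mxE enum_rankK.
have /submxP[y xy] : (x <= M)%MS by apply/MP; rewrite /= xv.
by exists y => //; rewrite -xy.
Qed.

(** * Hahn-Banach for sublinear functions *)

Section hahn_banach.
Context {R : realType} {U : lmodType R}.
Implicit Types (q : U -> R) (x y : U).

Definition sublinear q :=
  (forall x y, q (x + y) <= q x + q y) /\
  (forall t x, 0 <= t -> q (t *: x) = t * q x).

Lemma sublinear0 q : sublinear q -> q 0 = 0.
Proof. by move=> [_ qZ]; rewrite -(scale0r 0) qZ// mul0r. Qed.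

Lemma sublinear_oppr_ge q x : sublinear q -> 0 <= q x + q (- x).
Proof.
by move=> qs; rewrite -(sublinear0 qs) -(subrr x); exact: qs.1.
Qed.

(** The function [r] is the infimum over [t >= 0] of [q (x + t *: y) - t * q y]. Taking [t = 0]
    gives [r <= q], and [t = 1] at [- y] gives the last bound, which forces [r] to be odd at [y]. *)
Lemma sublinear_slope q y : sublinear q ->
  exists r, [/\ sublinear r, forall x, r x <= q x & r (- y) <= - q y].
Proof.
move=> qs; have [qD qZ] := qs.
pose Y x := [set q (x + t *: y) - t * q y | t in [set t : R | 0 <= t]].
have Ylb x : lbound (Y x) (- q (- x)).
  move=> _ [t t0 <-]; rewrite lerBrDr -qZ//.
  rewrite addrC lerBlDr.
  by have := qD (x + t *: y) (- x); rewrite addrAC subrr add0r.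
have Yinf x : has_inf (Y x).
  split; last by exists (- q (- x)); exact: Ylb.
  by exists (q (x + 0 *: y) - 0 * q y), 0 => /=.
have rle x t : 0 <= t -> inf (Y x) <= q (x + t *: y) - t * q y.
  by move=> t0; apply: ge_inf; [exact: (Yinf x).2|exists t].
have rge x z : (forall t, 0 <= t -> z <= q (x + t *: y) - t * q y) ->
    z <= inf (Y x).
  by move=> zP; apply: lb_le_inf; [exact: (Yinf x).1|move=> _ [t t0 <-]; exact: zP].
(* This half of homogeneity suffices: the converse is the same inequality for [s^-1]. *)
have rZ s x : 0 < s -> inf (Y (s *: x)) <= s * inf (Y x).
  move=> s0; rewrite -ler_pdivrMl//; apply: rge => t t0.
  rewrite ler_pdivrMl// mulrBr -(qZ s) ?(ltW s0)// scalerDr scalerA mulrA.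
  by apply: rle; rewrite mulr_ge0// ltW.
exists (fun x => inf (Y x)); split=> [|x|].
- split=> [x x'|t x].
    (* The two infima on the right are removed in turn; parameters [t] and [t'] compete with
       [t + t'] on the left. *)
    rewrite -lerBlDr; apply: (rge) => t t0; rewrite lerBlDr -lerBlDl.
    apply: rge => t' t'0; rewrite lerBlDl.
    apply: le_trans (rle (x + x') (t + t') (addr_ge0 t0 t'0)) _.
    have := qD (x + t *: y) (x' + t' *: y).
    rewrite addrACA -scalerDl; lra.
  rewrite le_eqVlt => /predU1P[<-|t0].
    rewrite scale0r mul0r; apply/eqP; rewrite eq_le; apply/andP; split.
      by have := rle 0 0 (lexx _); rewrite scale0r addr0 mul0r subr0 (sublinear0 qs).
    by apply: lb_le_inf (Yinf 0).1 _; have := Ylb 0; rewrite oppr0 (sublinear0 qs) oppr0.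
  apply/eqP; rewrite eq_le rZ//=.
  have ti : 0 < t^-1 by rewrite invr_gt0.
  have := rZ t^-1 (t *: x) ti.
  by rewrite scalerA mulVf ?gt_eqF// scale1r ler_pdivlMl.
- by have := rle x 0 (lexx _); rewrite scale0r addr0 mul0r subr0.
- have := rle (- y) 1 ler01.
  by rewrite scale1r addNr (sublinear0 qs) mul1r sub0r.
Qed.

(* Being odd at [y] passes to smaller sublinear functions, so the vectors of [s]
   can be treated one after the other; a sublinear function odd on a spanning
   family is linear. *)
Lemma sublinear_odd_on q (s : seq U) : sublinear q ->
  exists r, [/\ sublinear r, forall x, r x <= q x &
    {in s, forall y, r (- y) = - r y}].
Proof.
move=> qs; elim: s => [|y s [r [rs rq rodd]]]; first by exists q; split.
have [r' [r's r'r r'y]] := sublinear_slope y rs.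
exists r'; split => // [x|z]; first exact: le_trans (r'r x) (rq x).
have ge0 := sublinear_oppr_ge z r's.
rewrite inE => /predU1P[zy|/rodd rz]; apply/eqP; rewrite eq_le.
  subst z; have := r'r y; lra.
have := r'r z; have := r'r (- z); lra.
Qed.

End hahn_banach.

Lemma norming_functional (R : realType) (U : normedModType R) (S : set U)
    (x : U) : finite_dim_subspace S ->
  exists G : U -> R,
    [/\ forall c v w, S v -> S w -> G (c *: v + w) = c * G v + G w,
        forall v, `|G v| <= `|v| & G x = `|x| ].
Proof.
move=> [n [e ->]].
have ns : sublinear (fun v : U => `|v|).
  split=> [v w|t v t0]; first exact: ler_normD.
  by rewrite normrZ ger0_norm.
(* Sloping at [x] first pins the value there: the bound at [- x] passes to every smaller sublinear
   function and forces the value [|x|] at [x]. *)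
have [q [qs qle qx]] := sublinear_slope x ns.
have [r [rs rq rodd]] := sublinear_odd_on (codom e) qs.
(* Oddness at one summand already gives additivity, so the sum over the [e k] can be split term by
   term. *)
have rN v w : r (- v) = - r v -> r (v + w) = r v + r w.
  move=> rv; apply/eqP; rewrite eq_le rs.1/=.
  by have := rs.1 (v + w) (- v); rewrite addrAC subrr add0r rv; lra.
have rZ c v : r (- v) = - r v -> r (c *: v) = c * r v.
  move=> rv; have [c0|c0] := leP 0 c; first exact: rs.2.
  rewrite -[c]opprK scaleNr -scalerN rs.2 ?rv; last lra.
  by rewrite mulrN -mulNr.
have rS (c : 'I_n -> R) : r (\sum_k c k *: e k) = \sum_k c k * r (e k).
  elim/big_rec2: _ => [|k z v _ rz]; first exact: sublinear0.
  have ek : r (- e k) = - r (e k) by apply: rodd; exact: codom_f.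
  by rewrite rN -?rz ?rZ// -scalerN rZ ?opprK ?ek ?opprK// mulrN.
exists r; split=> [c v w [cv _ <-] [cw _ <-]|v|].
- rewrite scaler_sumr -big_split/=.
  under eq_bigr do rewrite scalerA -scalerDl.
  rewrite !rS mulr_sumr -big_split/=; apply: eq_bigr => k _.
  by rewrite mulrDl mulrA.
- have h1 := le_trans (rq v) (qle v); have h2 := le_trans (rq (- v)) (qle (- v)).
  have := sublinear_oppr_ge v rs; move: h2; rewrite normrN => h2 h3.
  rewrite ler_norml; lra.
- apply/eqP; rewrite eq_le (le_trans (rq x) (qle x))/=.
  have := sublinear_oppr_ge x rs; have := rq (- x); lra.
Qed.

(** * Families over the subdomains, with the sum of the norms *)

Section families.
Context {R : realType} {I : finType} {E E' : I -> normedModType R}.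
Implicit Types x y : forall i, E i.

Lemma sumnorm_ge0 x : 0 <= \sum_i `|x i|.
Proof. exact: sumr_ge0. Qed.

Lemma sumnorm_eq0 x : \sum_i `|x i| = 0 -> x = fun=> 0.
Proof.
move=> x0; apply: functional_extensionality_dep => i; apply/eqP.
by rewrite -normr_eq0 (psumr_eq0P _ x0).
Qed.

Lemma sumnormD x y : \sum_i `|x i + y i| <= \sum_i `|x i| + \sum_i `|y i|.
Proof. by rewrite -big_split; apply: ler_sum => i _; exact: ler_normD. Qed.

Lemma sum_bounded_form (F : forall i, E i -> E' i -> R) :
  (forall i, bounded_form (F i)) ->
  exists2 M : R, 0 < M & forall x (y : forall i, E' i),
    `|\sum_i F i (x i) (y i)| <= M * (\sum_i `|x i|) * (\sum_i `|y i|).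
Proof.
move=> /(_ _)/cid-/all_sig[M MP].
(* One positive constant dominates all the local bounds, whatever their signs and even if there are
   no subdomains. *)
have Mi i : `|M i| <= 1 + \sum_i `|M i|.
  by rewrite (bigD1 i)//= addrCA lerDl addr_ge0// sumr_ge0.
have M_gt0 : 0 < 1 + \sum_i `|M i| by rewrite ltr_pwDl// sumr_ge0.
exists (1 + \sum_i `|M i|) => // x y.
apply: le_trans (ler_norm_sum _ _ _) _.
rewrite mulr_sumr; apply: ler_sum => i _.
apply: le_trans (MP i _ _) _; apply: ler_wpM2r => //.
apply: le_trans (ler_wpM2r _ (le_trans (ler_norm _) (Mi i))) _ => //.
by apply: ler_wpM2l; rewrite ?(ltW M_gt0)// (bigD1 i)//= lerDl sumr_ge0.
Qed.

End families.

Lemma finite_dim_subspace0 (R : realType) (U : lmodType R) (S : set U) :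
  finite_dim_subspace S -> S 0.
Proof.
move=> [n [e ->]]; exists (fun=> 0) => //.
by rewrite big1// => k _; rewrite scale0r.
Qed.

Lemma finite_dim_subspaceP (R : realType) (U : lmodType R) (S : set U) c x y :
  finite_dim_subspace S -> S x -> S y -> S (c *: x + y).
Proof.
move=> [n [e ->]] [cx _ <-] [cy _ <-]; exists (fun k => c * cx k + cy k) => //.
rewrite scaler_sumr -big_split; apply: eq_bigr => k _ /=.
by rewrite scalerDl scalerA.
Qed.

(** * Linearity and boundedness of the global forms *)

Section forms.
Context {R : realType} {P : saddle_problem R}.
Implicit Types (u v : Vsp P) (p w : Wsp P).

(** Families are combined componentwise; differences are the case [c = -1], so one linearity rule
    per form covers both. *)
Definition combV (c : R) u v : Vsp P := fun i => c *: u i + v i.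
Definition combW (c : R) p w : Wsp P := fun i => c *: p i + w i.

Lemma combV0 c : combV c (fun=> 0) (fun=> 0) = fun=> 0.
Proof.
by apply: functional_extensionality_dep => i; rewrite /combV scaler0 addr0.
Qed.

Lemma combW0 c : combW c (fun=> 0) (fun=> 0) = fun=> 0.
Proof.
by apply: functional_extensionality_dep => i; rewrite /combW scaler0 addr0.
Qed.

Lemma subVE u v : subV u v = combV (-1) v u.
Proof.
by apply: functional_extensionality_dep => i; rewrite /combV scaleN1r addrC.
Qed.

Lemma subWE p w : subW p w = combW (-1) w p.
Proof.
by apply: functional_extensionality_dep => i; rewrite /combW scaleN1r addrC.
Qed.

Lemma aform_combl v c u u' :
  aform (combV c u u') v = c * aform u v + aform u' v.
Proof.
rewrite /aform mulr_sumr -big_split; apply: eq_bigr => i _; exact: linearPl.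
Qed.

Lemma aform_combr u c v v' :
  aform u (combV c v v') = c * aform u v + aform u v'.
Proof.
rewrite /aform mulr_sumr -big_split; apply: eq_bigr => i _; exact: linearPr.
Qed.

Lemma bform_combl w c v v' :
  bform (combV c v v') w = c * bform v w + bform v' w.
Proof.
rewrite /bform mulr_sumr -big_split; apply: eq_bigr => i _; exact: linearPl.
Qed.

Lemma bform_combr v c w w' :
  bform v (combW c w w') = c * bform v w + bform v w'.
Proof.
rewrite /bform mulr_sumr -big_split; apply: eq_bigr => i _; exact: linearPr.
Qed.

Lemma dualV_comb g c v v' :
  dualV g (combV c v v') = c * dualV g v + dualV g v'.
Proof.
rewrite /dualV mulr_sumr -big_split; apply: eq_bigr => i _; exact: linearPr.
Qed.

Lemma dualW_comb f c w w' :
  dualW f (combW c w w') = c * dualW f w + dualW f w'.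
Proof.
rewrite /dualW mulr_sumr -big_split; apply: eq_bigr => i _; exact: linearPr.
Qed.

Lemma aform_subl u u' v : aform (subV u u') v = aform u v - aform u' v.
Proof. by rewrite subVE aform_combl mulN1r addrC. Qed.

Lemma bform_subl v v' w : bform (subV v v') w = bform v w - bform v' w.
Proof. by rewrite subVE bform_combl mulN1r addrC. Qed.

Lemma bform_subr v w w' : bform v (subW w w') = bform v w - bform v w'.
Proof. by rewrite subWE bform_combr mulN1r addrC. Qed.

Lemma dualW_subl (f f' : datWsp P) w :
  dualW (subdatW f f') w = dualW f w - dualW f' w.
Proof. by rewrite /dualW -sumrB; apply: eq_bigr => i _; exact: linearBl. Qed.

Lemma normV_ge0 v : 0 <= normV v. Proof. exact: sumnorm_ge0. Qed.

Lemma normW_ge0 w : 0 <= normW w. Proof. exact: sumnorm_ge0. Qed.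

Lemma normV_gt0 v : v <> (fun=> 0) -> 0 < normV v.
Proof.
move=> v0; rewrite lt_neqAle normV_ge0 andbT eq_sym; apply/eqP => nv.
by apply: v0; exact: sumnorm_eq0 nv.
Qed.

Lemma normV_subC u v : normV (subV u v) = normV (subV v u).
Proof. by apply: eq_bigr => i _; rewrite /subV distrC. Qed.

Lemma normW_subC p w : normW (subW p w) = normW (subW w p).
Proof. by apply: eq_bigr => i _; rewrite /subW distrC. Qed.

Lemma normV_subD u v z : normV (subV u z) <= normV (subV u v) + normV (subV v z).
Proof.
apply: le_trans (sumnormD _ _); apply: ler_sum => i _.
by rewrite /subV addrA subrK.
Qed.

Lemma normW_subD p q w : normW (subW p w) <= normW (subW p q) + normW (subW q w).
Proof.
apply: le_trans (sumnormD _ _); apply: ler_sum => i _.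
by rewrite /subW addrA subrK.
Qed.

Lemma normV_sub_eq0 u v : normV (subV u v) = 0 -> u = v.
Proof.
move=> /sumnorm_eq0 uv; apply: functional_extensionality_dep => i.
by apply/eqP; rewrite -subr_eq0 -[u i - v i]/(subV u v i) uv.
Qed.

Lemma normW_sub_eq0 p w : normW (subW p w) = 0 -> p = w.
Proof.
move=> /sumnorm_eq0 pw; apply: functional_extensionality_dep => i.
by apply/eqP; rewrite -subr_eq0 -[p i - w i]/(subW p w i) pw.
Qed.

Lemma aform_bounded : exists2 M : R, 0 < M &
  forall u v, `|aform u v| <= M * normV u * normV v.
Proof. exact: sum_bounded_form (a_bounded P). Qed.

Lemma bform_bounded : exists2 M : R, 0 < M &
  forall v w, `|bform v w| <= M * normV v * normW w.
Proof. exact: sum_bounded_form (b_bounded P). Qed.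

Lemma dualW_bounded : exists2 M : R, 0 < M &
  forall f w, `|dualW f w| <= M * normdatW f * normW w.
Proof. exact: sum_bounded_form (pairW_bounded P). Qed.

End forms.

(** * The discrete spaces and solvability of discrete saddle point problems *)

Section discrete_spaces.
Context {R : realType} {P : saddle_problem R} {D : discretization P}.
Variables (hA1 : A1 D) (hA2 : A2 D) (h : mesh D).

Lemma Rhi_solution i l :
  extension_solution h l (xget 0 (@extension_solution _ _ D h i l)).
Proof. by have [x [xP _]] := hA2.1 h i l; apply: xgetPex; exists x. Qed.

Lemma Rhi_comb i c l l' :
  Rhi h i (c *: l + l') = c *: Rhi h i l + Rhi h i l'.
Proof.
have := Rhi_solution i l; have := Rhi_solution i l'; rewrite /Rhi.
case: (xget _ (extension_solution h l)) => [[u p] r].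
case: (xget _ (extension_solution h l')) => [[u' p'] r'] /=.
move=> [[Vu' Wp' Sr'] e1' e2' e3' e4'] [[Vu Wp Sr] e1 e2 e3 e4].
have [x [_ xu]] := hA2.1 h i (c *: l + l').
have <- : x = xget 0 (extension_solution h (c *: l + l')).
  exact/xu/Rhi_solution.
(* The combined triple solves the extension problem for the combined datum, so uniqueness identifies
   it with the chosen solution. *)
suff -> : x = (c *: u + u', c *: p + p', c *: r + r') by [].
apply: xu; split=> [|v0 v0P|w wP|s sP|].
- split; [exact: finite_dim_subspaceP (Vhi_fin _ h i) _ _|
          exact: finite_dim_subspaceP (Whi_fin _ h i) _ _|].
  by move=> v0 v0P; rewrite linearPr Sr// Sr'// mulr0 addr0.
- rewrite linearPl linearPr opprD addrACA -mulrBr e1// e1'//.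
  by rewrite mulr0 addr0.
- by rewrite linearP !linearPl opprD addrACA -mulrBr e2// e2'// mulr0 addr0.
- by rewrite linearP linearPl e3// e3'// mulr0 addr0.
- by rewrite !linearP e4 e4'.
Qed.

Lemma Vh_comb c u v : Vh D h u -> Vh D h v -> Vh D h (combV c u v).
Proof.
have [-> _ _ _] := hA1 h.
move=> [[u0 _] [/= u0P [l lP <-]] <-] [[v0 _] [/= v0P [l' lP' <-]] <-].
exists (combV c u0 v0, Rh h (c *: l + l')); last first.
  apply: functional_extensionality_dep => i /=.
  by rewrite /Rh Rhi_comb /combV scalerDr addrACA.
split=> /=; last first.
  by exists (c *: l + l') => //; exact: finite_dim_subspaceP (Lh_fin D h) _ _.
move=> i; have [u0i tu] := u0P i; have [v0i tv] := v0P i; split.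
  exact: finite_dim_subspaceP (Vhi_fin _ h i) _ _.
by rewrite /V0 /= linearP tu tv scaler0 addr0.
Qed.

Lemma Vh_Vhi v i : Vh D h v -> Vhi D h i (v i).
Proof.
have [-> _ _ _] := hA1 h => -[[v0 _] [/= v0P [l lP <-]] <-] /=.
have [v0i _] := v0P i; rewrite -[v0 i]scale1r.
apply: finite_dim_subspaceP (Vhi_fin _ h i) _ _ => //.
have := Rhi_solution i l; rewrite /Rh /Rhi.
by case: (xget _ _) => [[u p] r] [[]].
Qed.

(** The inf-sup condition at [w = 0] still provides a nonzero witness. It makes the supremum in the
    consistency error range over a nonempty set. *)
Lemma Vh_neq0 : b_infsup D -> exists2 v, Vh D h v & v <> (fun=> 0).
Proof.
have [_ _ _ WhE] := hA1 h.
move=> [c _ /(_ h (fun=> 0))] [|v [Vv v0 _]]; last by exists v.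
by rewrite WhE => i; exact: finite_dim_subspace0 (Whi_fin _ h i).
Qed.

Lemma Vh_sub u v : Vh D h u -> Vh D h v -> Vh D h (subV u v).
Proof. by move=> Vu Vv; rewrite subVE; exact: Vh_comb. Qed.

Lemma Vh_0 : b_infsup D -> Vh D h (fun=> 0).
Proof.
move=> /Vh_neq0[v Vv _]; have := Vh_sub Vv Vv; congr Vh.
by apply: functional_extensionality_dep => i; rewrite /subV subrr.
Qed.

Lemma Wh_comb c p w : Wh D h p -> Wh D h w -> Wh D h (combW c p w).
Proof.
have [_ _ _ ->] := hA1 h => pP wP i.
exact: finite_dim_subspaceP (Whi_fin _ h i) (pP i) (wP i).
Qed.

Lemma Wh_sub p w : Wh D h p -> Wh D h w -> Wh D h (subW p w).
Proof. by move=> Wp Ww; rewrite subWE; exact: Wh_comb. Qed.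

Lemma Wh_0 : Wh D h (fun=> 0).
Proof.
have [_ _ _ ->] := hA1 h => i.
exact: finite_dim_subspace0 (Whi_fin _ h i).
Qed.

Lemma infsup_eq0 q : b_infsup D -> Wh D h q ->
  (forall v, Vh D h v -> bform v q = 0) -> q = fun=> 0.
Proof.
move=> [c c0 /(_ h q)] bis Wq q0; have [v [Vv v0 bv]] := bis Wq.
apply: sumnorm_eq0; apply/eqP; rewrite eq_le normW_ge0 andbT.
by move: bv; rewrite q0// pmulr_rle0// mulr_gt0// normV_gt0.
Qed.

(** The form [al] is kept general so as to cover both [aform] and its transpose, and [G] need only
    be linear on the discrete space, as a norming functional is. *)
Lemma saddle_point_solvable (al : Vsp P -> Vsp P -> R)
    (G : Vsp P -> R) (F : Wsp P -> R) :
  b_infsup D ->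
  (forall c u u' v, al (combV c u u') v = c * al u v + al u' v) ->
  (forall c u v v', al u (combV c v v') = c * al u v + al u v') ->
  (forall c v v', Vh D h v -> Vh D h v' -> G (combV c v v') = c * G v + G v') ->
  (forall c w w', Wh D h w -> Wh D h w' -> F (combW c w w') = c * F w + F w') ->
  (forall v, Vh D h v -> (forall w, Wh D h w -> bform v w = 0) ->
     al v v = 0 -> v = fun=> 0) ->
  exists u p, [/\ Vh D h u, Wh D h p,
    forall v, Vh D h v -> al u v - bform v p = G v &
    forall w, Wh D h w -> bform u w = F w].
Proof.
move=> bis all_ alr Gl Fl coer.
have V_0 := Vh_0 bis; have W_0 := Wh_0.
have [n [phi [phil phiE]]] : exists n (phi : 'rV[R]_n -> Vsp P),
    (forall c x y, phi (c *: x + y) = combV c (phi x) (phi y)) /\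
    Vh D h = range phi.
  apply: (subspace_param (X := fun i => Vhi D h i)) => //.
  - by move=> i; exact: Vhi_fin.
  - by move=> v Vv i; exact: Vh_Vhi.
  - by move=> c x y; exact: Vh_comb.
have [m [psi [psil psiE]]] : exists m (psi : 'rV[R]_m -> Wsp P),
    (forall c x y, psi (c *: x + y) = combW c (psi x) (psi y)) /\
    Wh D h = range psi.
  apply: (subspace_param (X := fun i => Whi D h i)) => //.
  - by move=> i; exact: Whi_fin.
  - by have [_ _ _ ->] := hA1 h.
  - by move=> c x y; exact: Wh_comb.
have Vphi x : Vh D h (phi x) by rewrite phiE; exists x.
have Wpsi x : Wh D h (psi x) by rewrite psiE; exists x.
(* Coordinates [x0] and [y0] of zero isolate one equation of the coupled system: [row_mx x y0] tests
   the first, [row_mx x0 y] the second. *)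
have [x0 _ x0E] : range phi (fun=> 0) by rewrite -phiE.
have [y0 _ y0E] : range psi (fun=> 0) by rewrite -psiE.
have G0 : G (fun=> 0) = 0.
  by have := Gl (-1) _ _ V_0 V_0; rewrite combV0 mulN1r addNr.
have F0 : F (fun=> 0) = 0.
  by have := Fl (-1) _ _ W_0 W_0; rewrite combW0 mulN1r addNr.
have b0l w : bform (fun=> 0) w = 0 :> R.
  by apply: big1 => i _; exact: linear0l.
have b0r (v : Vsp P) : bform v (fun=> 0) = 0.
  by apply: big1 => i _; exact: linear0r.
have al0 v : al (fun=> 0) v = 0.
  by have := all_ (-1) (fun=> 0) (fun=> 0) v; rewrite combV0 mulN1r addNr.
have al0r v : al v (fun=> 0) = 0.
  by have := alr (-1) v (fun=> 0) (fun=> 0); rewrite combV0 mulN1r addNr.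
pose u (z : 'rV[R]_(n + m)) := phi (lsubmx z).
pose p (z : 'rV[R]_(n + m)) := psi (rsubmx z).
have ul c z z' : u (c *: z + z') = combV c (u z) (u z').
  by rewrite /u linearP phil.
have pl c z z' : p (c *: z + z') = combW c (p z) (p z').
  by rewrite /p linearP psil.
have uE x y : u (row_mx x y) = phi x by rewrite /u row_mxKl.
have pE x y : p (row_mx x y) = psi y by rewrite /p row_mxKr.
have Vu z : Vh D h (u z) := Vphi _.
have Wp z : Wh D h (p z) := Wpsi _.
pose B z z' := al (u z) (u z') - bform (u z') (p z) + bform (u z) (p z').
pose L z := G (u z) + F (p z).
have [z'|z|c z z'|z' kz'|z zP] := @galerkin_solvable R (n + m) B L.
- move=> c z1 z2; rewrite /B /= ul pl all_ bform_combr bform_combl; ring.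
- move=> c z1 z2; rewrite /B /= ul pl alr bform_combr bform_combl; ring.
- by rewrite /L /= ul pl (Gl _ _ _ (Vu _) (Vu _)) (Fl _ _ _ (Wp _) (Wp _)); ring.
(* A kernel vector solves the homogeneous transposed problem: testing with [u z'] itself gives
   [u z' = 0] by coercivity, then inf-sup gives [p z' = 0]. *)
- have testV v : Vh D h v -> al v (u z') + bform v (p z') = 0.
    rewrite phiE => -[x _ <-]; have := kz' (row_mx x y0).
    by rewrite /B uE pE y0E b0r subr0.
  have testW w : Wh D h w -> bform (u z') w = 0.
    rewrite psiE => -[y _ <-]; have := kz' (row_mx x0 y).
    rewrite /B uE pE x0E b0l al0 sub0r addr0.
    by move/eqP; rewrite oppr_eq0 => /eqP.
  have uz' : u z' = fun=> 0.
    apply: (coer _ (Vu z') testW _).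
    by have := testV _ (Vu z'); rewrite testW ?addr0.
  have pz' : p z' = fun=> 0.
    apply: (infsup_eq0 bis (Wp z') _) => v Vv.
    have := testV _ Vv; rewrite uz'.
    by rewrite al0r add0r.
  by rewrite /L uz' pz' G0 F0 addr0.
exists (u z), (p z); split=> [|||w].
- exact: Vphi.
- exact: Wpsi.
- move=> v; rewrite phiE => -[x _ <-]; have := zP (row_mx x y0).
  by rewrite /B /L uE pE y0E b0r F0 !addr0.
- rewrite psiE => -[y _ <-]; have := zP (row_mx x0 y).
  rewrite /B /L uE pE x0E b0l G0 add0r subr0.
  by rewrite al0r add0r.
Qed.

End discrete_spaces.

(** * Existence, stability, uniqueness and the error estimate *)

Section wellposedness.
Context {R : realType} {P : saddle_problem R} {D : discretization P}.
Variables (hA1 : A1 D) (hA2 : A2 D) (hA3 : A3 D).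

Lemma coercive_kernel_eq0 (h : mesh D) (v : Vsp P) :
  Vh D h v -> (forall w, Wh D h w -> bform v w = 0) -> aform v v = 0 ->
  v = fun=> 0.
Proof.
have [_ _ [c c0 coer] _] := hA3 => Vv kv av.
apply: sumnorm_eq0; apply/eqP; rewrite -sqrf_eq0 eq_le sqr_ge0 andbT.
by have := coer h v Vv kv; rewrite av pmulr_rle0.
Qed.

Lemma discrete_solution_exists (h : mesh D) (f : datWsp P) (g : datVsp P) :
  exists u p, discrete_solution h f g u p.
Proof.
have [_ _ _ bis] := hA3.
have [||c v v' _ _|c w w' _ _||] :=
  @saddle_point_solvable _ _ D hA1 hA2 h (@aform _ P) (dualV g) (dualW f) bis.
- by move=> *; exact: aform_combl.
- by move=> *; exact: aform_combr.
- exact: dualV_comb.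
- exact: dualW_comb.
- by move=> v; exact: coercive_kernel_eq0.
- by move=> u [p up]; exists u, p.
Qed.

(** Since [normV] is a sum over the subdomains, local norming functionals of the components add up
    to a global one. *)
Lemma Vh_norming_functional (h : mesh D) (u : Vsp P) : exists G : Vsp P -> R,
  [/\ forall c v v', Vh D h v -> Vh D h v' -> G (combV c v v') = c * G v + G v',
      forall v, G v <= normV v & G u = normV u].
Proof.
have /all_sig[G GP] i := cid (norming_functional (u i) (Vhi_fin D h i)).
exists (fun v => \sum_i G i (v i)); split=> [c v v' Vv Vv'|v|].
- rewrite mulr_sumr -big_split; apply: eq_bigr => i _.
  by have [-> //] := GP i; exact: Vh_Vhi.
- apply: ler_sum => i _; have [_ Gn _] := GP i.
  exact: le_trans (ler_norm _) (Gn _).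
- by apply: eq_bigr => i _; have [] := GP i.
Qed.

(** The inf-sup witness for [q] has positive norm, which cancels from both bounds on [bform v q]. *)
Lemma infsup_norm_le c (h : mesh D) q K :
  (forall w, Wh D h w -> exists v : Vsp P,
      [/\ Vh D h v, v <> (fun=> 0) & c * normV v * normW w <= bform v w]) ->
  Wh D h q -> (forall v, Vh D h v -> bform v q <= K * normV v) ->
  c * normW q <= K.
Proof.
move=> bis Wq bK; have [v [Vv v0 bv]] := bis q Wq.
rewrite -(ler_pM2r (normV_gt0 v0)) mulrAC.
exact: le_trans bv (bK v Vv).
Qed.

(* Solving an adjoint problem replaces the closed range theorem, since the norms
   are not Hilbertian. *)
Lemma constraint_stability : exists2 C : R, 0 < C &
  forall (h : mesh D) (u : Vsp P) (p : Wsp P) K,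
    Vh D h u -> Wh D h p -> 0 <= K ->
    (forall v, Vh D h v -> aform u v - bform v p = 0) ->
    (forall w, Wh D h w -> bform u w <= K * normW w) ->
    normV u + normW p <= C * K.
Proof.
have [_ _ [al al0 coer] bis] := hA3; have [c c0 cP] := bis.
have [M M0 aM] := @aform_bounded R P.
exists ((1 + M / c) * ((1 + M / al) / c)).
  by rewrite mulr_gt0 ?divr_gt0 ?addr_gt0 ?divr_gt0.
move=> h u p K Vu Wp K0 e1 e2.
have [G [Gl Gn Gu]] := Vh_norming_functional h u.
(* The adjoint problem has datum [G] and zero constraint, so its solution [v] lies in the kernel of
   [b] and [aform v v = G v <= normV v]. *)
have [|||c' w w' _ _||v [q [Vv Wq e3 e4]]] :=
  @saddle_point_solvable _ _ D hA1 hA2 h (fun v x => aform x v) G (fun=> 0) bis.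
- by move=> *; exact: aform_combr.
- by move=> *; exact: aform_combl.
- exact: Gl.
- by rewrite mulr0 addr0.
- by move=> v; exact: coercive_kernel_eq0.
have vle : al * normV v <= 1.
  have [v0|v0] := eqVneq (normV v) 0; first by rewrite v0 mulr0.
  have nv : 0 < normV v by rewrite lt_neqAle eq_sym v0 normV_ge0.
  rewrite -(ler_pM2r nv) -mulrA mul1r -expr2.
  apply: le_trans (coer h v Vv e4) _.
  by have := e3 v Vv; rewrite e4// subr0 => ->.
have nvle : normV v <= al^-1 by rewrite -ler_pdivlMl// mulr1 in vle.
(* The sign is changed because the assumed bound on [bform u w] is one-sided and is applied with
   [w = q']. *)
pose q' := subW (fun=> 0) q.
have Wq' : Wh D h q' by apply: Wh_sub => //; exact: Wh_0.
have bq' x : bform x q' = - bform x q.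
  rewrite bform_subr [X in X - _](_ : _ = 0) ?sub0r//.
  by apply: big1 => i _; exact: linear0r.
have qle : normW q' <= (1 + M / al) / c.
  rewrite ler_pdivlMr// mulrC; apply: infsup_norm_le (cP h) Wq' _ => x Vx.
  have -> : bform x q' = G x - aform x v by rewrite bq' -(e3 x Vx); ring.
  have := aM x v; rewrite ler_norml => /andP[lx _].
  have : M * normV x * normV v <= M * normV x * al^-1.
    by apply: ler_wpM2l nvle; rewrite mulr_ge0 ?normV_ge0// ltW.
  have := Gn x; rewrite mulrDl mul1r (mulrAC M); lra.
(* By duality [normV u = G u = aform u v - bform u q]; here [aform u v = bform v p = 0], which
   leaves [bform u q']. *)
have ule : normV u <= (1 + M / al) / c * K.
  rewrite -Gu -e3// (_ : aform u v = bform v p); last first.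
    by apply/eqP; rewrite -subr_eq0 e1.
  rewrite e4// add0r -bq'; apply: le_trans (e2 _ Wq') _.
  by rewrite mulrC; exact: ler_wpM2r.
have ple : c * normW p <= M * normV u.
  apply: infsup_norm_le (cP h) Wp _ => x Vx.
  have -> : bform x p = aform u x.
    by apply/eqP; rewrite eq_sym -subr_eq0 e1.
  exact: le_trans (ler_norm _) (aM _ _).
have ple' : normW p <= M / c * normV u.
  by rewrite mulrAC ler_pdivlMr// mulrC.
rewrite -mulrA; apply: (@le_trans _ _ ((1 + M / c) * normV u)).
  by rewrite mulrDl mul1r lerD2l.
by apply: ler_wpM2l ule; rewrite ltW// addr_gt0// divr_gt0.
Qed.

Lemma discrete_stability : exists2 C : R, 0 < C &
  forall (h : mesh D) (f f' : datWsp P) (g : datVsp P) (uh uh' : Vsp P) (ph ph' : Wsp P),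
    discrete_solution h f g uh ph -> discrete_solution h f' g uh' ph' ->
    normV (subV uh uh') + normW (subW ph ph')
      <= C * normdatW (subdatW f f').
Proof.
have [C C0 CP] := constraint_stability.
have [M M0 fM] := @dualW_bounded R P.
exists (C * M) => [|h f f' g u u' p p' [Vu Wp e1 e2] [Vu' Wp' e1' e2']].
  exact: mulr_gt0.
rewrite -mulrA; apply: (CP h).
- exact: Vh_sub.
- exact: Wh_sub.
- by rewrite mulr_ge0 ?(ltW M0)//; exact: sumnorm_ge0.
- move=> v Vv; rewrite aform_subl bform_subr.
  by have := e1 v Vv; have := e1' v Vv; lra.
- move=> w Ww; rewrite bform_subl e2// e2'// -dualW_subl.
  exact: le_trans (ler_norm _) (fM _ _).
Qed.

Lemma discrete_solution_unique (h : mesh D) (f : datWsp P) (g : datVsp P)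
    (uh uh' : Vsp P) (ph ph' : Wsp P) :
  discrete_solution h f g uh ph -> discrete_solution h f g uh' ph' ->
  (uh, ph) = (uh', ph').
Proof.
have [C C0 CP] := discrete_stability => s s'.
have := CP _ _ _ _ _ _ _ _ s s'.
have -> : normdatW (subdatW f f) = 0.
  by apply: big1 => i _; rewrite /subdatW subrr normr0.
rewrite mulr0 => le0.
have V0 := normV_ge0 (subV uh uh'); have W0 := normW_ge0 (subW ph ph').
congr (_, _); [apply: normV_sub_eq0|apply: normW_sub_eq0]; lra.
Qed.

(** The supremum controls the signed residual at nonzero [v]; applying it to [- v] as well yields
    the absolute value, and [v = 0] is checked separately. *)
Lemma consistency_residual_le (h : mesh D) (g : datVsp P) (u : Vsp P) (p : Wsp P) (e : R) :
  (consistency_error h g u p <= e%:E)%E ->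
  forall v, Vh D h v -> `|aform u v - bform v p - dualV g v| <= e * normV v.
Proof.
move=> Ee v Vv.
pose r (v : Vsp P) := aform u v - bform v p - dualV g v.
have rl c v1 v2 : r (combV c v1 v2) = c * r v1 + r v2.
  by rewrite /r aform_combr bform_combl dualV_comb; ring.
have rE x : Vh D h x -> x <> (fun=> 0) -> r x <= e * normV x.
  move=> Vx x0; rewrite -ler_pdivrMr ?normV_gt0// -lee_fin.
  by apply: le_trans Ee; apply: ereal_sup_ubound; exists x.
have V_0 : Vh D h (fun=> 0) by have [_ _ _ bis] := hA3; exact: Vh_0.
have nV0 : normV ((fun=> 0) : Vsp P) = 0 by apply: big1 => i _; rewrite normr0.
have r0 : r (fun=> 0) = 0.
  by have := rl (-1) (fun=> 0) (fun=> 0); rewrite combV0 mulN1r addNr.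
have [->|v0] := pselect (v = fun=> 0); first by rewrite -/(r _) r0 nV0 normr0 mulr0.
rewrite -/(r v) ler_norml rE// andbT.
have vN : r (subV (fun=> 0) v) = - r v by rewrite subVE rl r0 addr0 mulN1r.
have nN : normV (subV (fun=> 0) v) = normV v.
  by rewrite normV_subC; apply: eq_bigr => i _; rewrite /subV subr0.
rewrite lerNl -vN -nN; apply: rE; first exact: Vh_sub.
move=> v0'; have := normV_gt0 v0; rewrite -nN v0' nV0; lra.
Qed.

Lemma error_estimate : exists2 C : R, 0 < C &
  forall (h : mesh D) (f : datWsp P) (g : datVsp P) (u : Vsp P) (p : Wsp P)
    (uh : Vsp P) (ph : Wsp P) (e : R),
    continuous_solution f g u p -> A4 D u -> discrete_solution h f g uh ph ->
    (forall v, Vh D h v -> `|aform u v - bform v p - dualV g v| <= e * normV v) ->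
    normV (subV u uh) + normW (subW p ph) <=
    C * (normV (subV (PiV D h u) u) + normW (subW (PiW D h p) p) + e).
Proof.
have [_ _ [al al0 coer] [c c0 cP]] := hA3.
have [Ma Ma0 aM] := @aform_bounded R P.
have [Mb Mb0 bM] := @bform_bounded R P.
pose M := 1 + Ma + Mb; pose K := 1 + M / al.
have M0 : 0 < M by rewrite /M; lra.
have K0 : 0 < K by rewrite addr_gt0 ?divr_gt0.
(* [K] bounds the error in [u], the last term bounds [ph - PiW p], and [1] accounts for the
   interpolation error of [p]. *)
exists (1 + K + (Ma * K + M) / c).
  by rewrite !addr_gt0 ?divr_gt0 ?addr_gt0 ?mulr_gt0.
move=> h f g u p uh ph e [Vu Wp c1 c2] a4 [Vuh Wph d1 d2] res.
have VPu : Vh D h (PiV D h u) by rewrite -PiV_range; exists u.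
have WPp : Wh D h (PiW D h p) by rewrite -PiW_range; exists p.
set eu := normV (subV (PiV D h u) u); set ep := normW (subW (PiW D h p) p).
set eta := eu + ep + e.
pose v := subV uh (PiV D h u); pose q := subW ph (PiW D h p).
have Vv : Vh D h v by exact: Vh_sub.
have Wq : Wh D h q by exact: Wh_sub.
have eu0 : 0 <= eu := normV_ge0 _; have ep0 : 0 <= ep := normW_ge0 _.
(* A nonzero discrete [x] turns the residual bound into nonnegativity of [e]. *)
have e0 : 0 <= e.
  have [x Vx x0] := Vh_neq0 hA1 h (let: And4 _ _ _ b := hA3 in b).
  have := le_trans (normr_ge0 _) (res x Vx).
  by rewrite pmulr_lge0// normV_gt0.
have Meta : Ma * eu + Mb * ep + e <= M * eta.
  have := mulr_ge0 (ltW Ma0) eu0; have := mulr_ge0 (ltW Mb0) ep0.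
  have := mulr_ge0 (ltW Ma0) ep0; have := mulr_ge0 (ltW Mb0) eu0.
  have := mulr_ge0 (ltW Ma0) e0; have := mulr_ge0 (ltW Mb0) e0.
  rewrite /M /eta; lra.
(* Both [uh] and [u] satisfy the constraint against [w], the latter by conformity of [Wh], and [A4]
   replaces [u] by its interpolant. *)
have kv w : Wh D h w -> bform v w = 0.
  move=> Ww; have := a4 h w Ww; rewrite !bform_subl d2// -c2; last exact: Wh_conform Ww.
  by lra.
have vle : al * normV v <= M * eta.
  have [v0|v0] := eqVneq (normV v) 0.
    by rewrite v0 mulr0 mulr_ge0 ?(ltW M0)// /eta !addr_ge0.
  have nv : 0 < normV v by rewrite lt_neqAle eq_sym v0 normV_ge0.
  rewrite -(ler_pM2r nv) -mulrA -expr2.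
  apply: le_trans (coer h v Vv kv) _.
  (* Since [v] is in the kernel of [b], the discrete pressure drops out and [PiW p] may be inserted,
     leaving interpolation errors and the residual. *)
  have -> : aform v v = - aform (subV (PiV D h u) u) v
      + bform v (subW (PiW D h p) p) - (aform u v - bform v p - dualV g v).
    have := d1 v Vv; rewrite (kv ph)// {2}/v !aform_subl bform_subr (kv (PiW D h p))//.
    by lra.
  apply: le_trans (ler_wpM2r (ltW nv) Meta).
  have := aM (subV (PiV D h u) u) v; rewrite ler_norml => /andP[h1 _].
  have := bM v (subW (PiW D h p) p); rewrite ler_norml => /andP[_ h2].
  have := res v Vv; rewrite ler_norml => /andP[h3 _].
  rewrite -/eu -/ep in h1 h2; rewrite !mulrDl (mulrAC Mb); lra.
have nvle : normV v <= M / al * eta by rewrite mulrAC ler_pdivlMr// mulrC.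
have uK : normV (subV u uh) <= K * eta.
  rewrite normV_subC; apply: le_trans (normV_subD uh (PiV D h u) u) _.
  rewrite -/v -/eu /K mulrDl mul1r addrC; apply: lerD nvle.
  by rewrite /eta; lra.
have qle : c * normW q <= (Ma * K + M) * eta.
  apply: infsup_norm_le (cP h) Wq _ => x Vx.
  have -> : bform x q = aform (subV uh u) x
     + (aform u x - bform x p - dualV g x) - bform x (subW (PiW D h p) p).
    have := d1 x Vx; rewrite !aform_subl !bform_subr; lra.
  have nx := normV_ge0 x.
  have := aM (subV uh u) x; rewrite normV_subC ler_norml => /andP[_ h1].
  have := bM x (subW (PiW D h p) p); rewrite ler_norml -/ep => /andP[h2 _].
  have := res x Vx; rewrite ler_norml => /andP[_ h3].
  have h4 : Ma * normV (subV u uh) * normV x <= Ma * (K * eta) * normV x.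
    by apply: ler_wpM2r => //; apply: ler_wpM2l => //; exact: ltW.
  have h5 := ler_wpM2r nx Meta.
  (* [Meta] also contains the term [Ma * eu], absent from this estimate, so its sign is required to
     discard it. *)
  have h6 : 0 <= Ma * eu * normV x by rewrite !mulr_ge0// ltW.
  move: h1 h2 h3 h4 h5 h6; clear; clearbody K M eta ep; lra.
have nqle : normW q <= (Ma * K + M) / c * eta by rewrite mulrAC ler_pdivlMr// mulrC.
have pK : normW (subW p ph) <= (Ma * K + M) / c * eta + eta.
  rewrite normW_subC; apply: le_trans (normW_subD ph (PiW D h p) p) _.
  by apply: lerD nqle _; rewrite -/ep /eta; lra.
apply: le_trans (lerD uK pK) _; rewrite -/eta le_eqVlt; apply/orP; left.
by apply/eqP; ring.
Qed.

End wellposedness.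

Theorem theorem7p1 (R : realType) (P : saddle_problem R)
    (D : discretization P) (hA1 : A1 D) (hA2 : A2 D) (hA3 : A3 D) :
  [/\ forall (h : mesh D) (f : datWsp P) (g : datVsp P),
        exists! x : Vsp P * Wsp P, discrete_solution h f g x.1 x.2,
      exists2 C : R, 0 < C &
        forall (h : mesh D) (f f' : datWsp P) (g : datVsp P)
               (uh uh' : Vsp P) (ph ph' : Wsp P),
          discrete_solution h f g uh ph ->
          discrete_solution h f' g uh' ph' ->
          normV (subV uh uh') + normW (subW ph ph')
            <= C * normdatW (subdatW f f')
    & exists2 C : R, 0 < C &
        forall (f : datWsp P) (g : datVsp P) (u : Vsp P) (p : Wsp P),
          continuous_solution f g u p -> A4 D u ->
          forall (h : mesh D) (uh : Vsp P) (ph : Wsp P),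
            discrete_solution h f g uh ph ->
            ((normV (subV u uh) + normW (subW p ph))%:E <=
             C%:E * ((normV (subV (PiV D h u) u) + normW (subW (PiW D h p) p))%:E
                     + consistency_error h g u p))%E].
Proof.
split=> [h f g||].
- have [u [p up]] := discrete_solution_exists hA1 hA2 hA3 h f g.
  exists (u, p); split=> // -[u' p'] /= up'.
  exact (discrete_solution_unique hA1 hA2 hA3 up up').
- exact: discrete_stability.
have [C C0 CP] := error_estimate hA1 hA2 hA3.
exists C => // f g u p cs a4 h uh ph ds.
have := @consistency_residual_le _ _ D hA1 hA2 hA3 h g u p.
(* The supremum is an extended real: a finite value gives the real estimate, [+oo] makes the bound
   trivial because [C] is positive, and [-oo] is excluded by a nonzero discrete vector. *)
case E : (consistency_error h g u p) => [e| |] resP.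
- rewrite -EFinD -EFinM lee_fin.
  exact: CP cs a4 ds (resP e (lexx _)).
- by rewrite addey// mulry gtr0_sg// mul1e leey.
- have [_ _ _ bis] := hA3; have [x Vx x0] := Vh_neq0 hA1 h bis.
  have : (((aform u x - bform x p - dualV g x) / normV x)%:E <= -oo)%E.
    by rewrite -E; apply: ereal_sup_ubound; exists x.
  by [].
Qed.
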